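(* Let $n\ge 3$, $0<m<\frac{n-2}{n}$, $\eta>0$, $\rho>0$, and let $\alpha,\beta\in\mathbb{R}$ satisfy $\alpha=\frac{2\beta+\rho}{1-m}$ and $\beta>\frac{m\rho}{n-2-mn}$. Suppose $v$ is a solution of $$\frac{n-1}{m}\left((v^m)''+\frac{n-1}{r}(v^m)'\right)+\alpha v+\beta r v'=0,\quad v>0,\quad \text{in }(0,\infty),$$ with $v(0)=\eta$, $v'(0)=0$. Then $$\lim_{r\to\infty} r^2 v(r)^{1-m}=\frac{2(n-1)(n(1-m)-2)}{(1-m)(\alpha(1-m)-2\beta)}.$$
   Context: This ODE is the equation satisfied by radially symmetric solutions $v(|x|)$ of $\frac{n-1}{m}\Delta v^m+\alpha v+\beta x\cdot\nabla v=0$, $v>0$, in $\mathbb{R}^n$. *)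

(* Defs.v *)
From Stdlib Require Import Reals.
From Coquelicot Require Import Coquelicot.
Open Scope R_scope.

(* u(r) = v(r)^m, with real exponent m (v > 0 where it is used). *)
Definition powf (v : R -> R) (m : R) : R -> R := fun r => Rpower (v r) m.

(* Main.v *)
Require Import Defs.
From Stdlib Require Import Reals Lra.
From Coquelicot Require Import Coquelicot.
Open Scope R_scope.

(** In the variable [t = ln r], put [y = r v' / v + 2 / (1 - m)] and
    [w = r^2 v^(1-m)].  The equation becomes the autonomous system
    [y' = P(y) - w (K + B y)], [w' = k w y], with [P] a concave quadratic, and
    the claim is that [w] tends to its equilibrium value [P(0) / K].
    The condition on [beta] says exactly that [P > 0] on the line [K + B y = 0],
    so the half plane [u = K + B y > 0], which contains the trajectory near
    [r = 0], is forward invariant.  In the coordinates [ln u], [ln w] the system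
    has separated variables up to a dissipative term, as for Lotka-Volterra, so
    [k / B^2 (u - K ln u) + w - (P(0) / K) ln w] is a Lyapunov function,
    and a Barbalat argument concludes. *)

(** * Real-analysis tools: increments, Barbalat convergence, logarithmic bounds, linear equations *)

Lemma increment_le (f df : R -> R) (C a b : R) :
  a <= b ->
  (forall t, a <= t <= b -> is_derive f t (df t)) ->
  (forall t, a <= t <= b -> df t <= C) ->
  f b - f a <= C * (b - a).
Proof.
  intros Hab Hd Hle.
  destruct (MVT_gen f a b df) as [x [Hx ->]].
  - intros x; rewrite Rmin_left, Rmax_right by lra; intros; apply Hd; lra.
  - intros x; rewrite Rmin_left, Rmax_right by lra; intros.
    apply continuity_pt_filterlim.
    apply (ex_derive_continuous f). eexists. apply Hd; lra.
  - rewrite Rmin_left, Rmax_right in Hx by lra.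
    apply Rmult_le_compat_r; [lra | now apply Hle].
Qed.

Lemma lipschitz_of_derive (f df : R -> R) (M a b : R) :
  a <= b ->
  (forall t, a <= t <= b -> is_derive f t (df t)) ->
  (forall t, a <= t <= b -> Rabs (df t) <= M) ->
  Rabs (f b - f a) <= M * (b - a).
Proof.
  intros Hab Hd HM.
  apply Rabs_le; split.
  - assert (H := increment_le (fun t => - f t) (fun t => - df t) M a b Hab).
    cbv beta in H.
    enough (- f b - - f a <= M * (b - a)) by lra.
    apply H.
    + intros t Ht. apply (is_derive_opp f), Hd, Ht.
    + intros t Ht. assert (H' := HM t Ht). apply Rabs_le_between in H'; lra.
  - apply increment_le with df; auto.
    intros t Ht. assert (H' := HM t Ht). apply Rabs_le_between in H'; lra.
Qed.

(* A Barbalat lemma: each excursion of [x] of size [e] lasts at least [e / 2M],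
   and costs [V] a fixed amount, while the total decrease of [V] is finite. *)
Lemma barbalat (V dV x dx : R -> R) (t0 c M b : R) :
  0 < c -> 0 < M ->
  (forall t, t0 <= t -> is_derive V t (dV t)) ->
  (forall t, t0 <= t -> is_derive x t (dx t)) ->
  (forall t, t0 <= t -> dV t <= - c * (x t) ^ 2) ->
  (forall t, t0 <= t -> Rabs (dx t) <= M) ->
  (forall t, t0 <= t -> b <= V t) ->
  is_lim x p_infty 0.
Proof.
  intros Hc HM HV Hx HdV Hdx Hb.
  destruct (completeness (fun s => exists t, t0 <= t /\ s = - V t)) as [l [Hub Hlub]].
  { exists (- b). intros s [t [Ht ->]]. specialize (Hb t Ht). lra. }
  { exists (- V t0), t0. split; lra. }
  apply is_lim_spec. intros e.
  destruct e as [e He]; simpl.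
  (* The drop of [V] forced by one excursion: rate at least [c * (e / 2) ^ 2] for a time
     [e / (2 * M)]. *)
  set (d := c * (e / 2) ^ 2 * (e / (2 * M))).
  assert (Htau : 0 < e / (2 * M)) by (apply Rdiv_lt_0_compat; lra).
  assert (Hd : 0 < d).
  { apply Rmult_lt_0_compat; [apply Rmult_lt_0_compat|]; [lra| |lra]. apply pow_lt; lra. }
  (* Since [- l] is the infimum of [V], from some [T] on there is no room left for a drop of size
     [d]. *)
  assert (HT : exists T, t0 <= T /\ V T < - l + d).
  { destruct (Classical_Prop.classic (exists T, t0 <= T /\ V T < - l + d)) as [?|Hn]; [assumption|].
    assert (H : l <= l - d); [|lra].
    apply Hlub. intros s [t [Ht ->]].
    destruct (Rlt_le_dec (V t) (- l + d)); [|lra].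
    exfalso; apply Hn; now exists t. }
  destruct HT as [T [HT0 HT]].
  exists T. intros t Ht. rewrite Rminus_0_r.
  destruct (Rlt_le_dec (Rabs (x t)) e) as [?|Hbig]; [assumption|exfalso].
  assert (H1 : V t - V T <= 0 * (t - T)).
  { apply increment_le with dV; [lra| intros; apply HV; lra |].
    intros s Hs. apply Rle_trans with (1 := HdV s ltac:(lra)).
    assert (0 <= x s ^ 2) by apply pow2_ge_0. nra. }
  assert (H2 : V (t + e / (2 * M)) - V t <= - (c * (e / 2) ^ 2) * (t + e / (2 * M) - t)).
  { apply increment_le with dV; [lra| intros; apply HV; lra |].
    intros s Hs. apply Rle_trans with (1 := HdV s ltac:(lra)).
    assert (Hl : Rabs (x s - x t) <= M * (s - t)).
    { apply lipschitz_of_derive with dx; [lra| |]; intros; [apply Hx|apply Hdx]; lra. }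
    assert (Hl' : M * (s - t) <= e / 2).
    { replace (e / 2) with (M * (e / (2 * M))) by (field; lra).
      apply Rmult_le_compat_l; lra. }
    assert (Hs2 : e / 2 <= Rabs (x s)).
    { assert (H := Rabs_triang_inv (x t) (x s)).
      rewrite Rabs_minus_sym in Hl. lra. }
    rewrite <- (pow2_abs (x s)).
    assert ((e / 2) ^ 2 <= Rabs (x s) ^ 2) by (apply pow_incr; lra).
    nra. }
  assert (H3 : - V (t + e / (2 * M)) <= l) by (apply Hub; exists (t + e / (2 * M)); split; lra).
  replace (t + e / (2 * M) - t) with (e / (2 * M)) in H2 by ring.
  unfold d in *. lra.
Qed.

(** By ln s <= s at s = x / (2 a), the logarithmic term costs at most x / 2 plus a constant. This
    turns a bound on the Lyapunov function into bounds on the variables. *)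
Lemma le_of_sub_ln_le (a x C : R) :
  0 < a -> 0 < x -> x - a * ln x <= C -> x <= 2 * (C + a * ln (2 * a)).
Proof.
  intros Ha Hx H.
  assert (Hl : ln (x / (2 * a)) <= x / (2 * a)).
  { assert (H1 := exp_ineq1_le (ln (x / (2 * a)))).
    rewrite exp_ln in H1 by (apply Rdiv_lt_0_compat; lra). lra. }
  rewrite ln_div in Hl by lra.
  assert (a * (ln x - ln (2 * a)) <= x / 2).
  { replace (x / 2) with (a * (x / (2 * a))) by (field; lra).
    apply Rmult_le_compat_l; lra. }
  lra.
Qed.

(** The minimum is attained at [x = a]; use 1 + s <= exp s at s = ln (x / a). *)
Lemma sub_ln_ge (a x : R) :
  0 < a -> 0 < x -> a - a * ln a <= x - a * ln x.
Proof.
  intros Ha Hx.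
  assert (H1 := exp_ineq1_le (ln (x / a))).
  rewrite exp_ln in H1 by (apply Rdiv_lt_0_compat; lra).
  rewrite ln_div in H1 by lra.
  assert (a * (1 + (ln x - ln a)) <= x); [|lra].
  replace x with (a * (x / a)) at 2 by (field; lra).
  apply Rmult_le_compat_l; lra.
Qed.

(** Integrating factor: [u] times exp (- I), with I the integral of [q] from [t0], is nondecreasing
    because [g] is nonnegative. *)
Lemma linear_ode_pos (u g q : R -> R) (t0 t : R) :
  (forall s, continuous q s) ->
  (forall s, 0 <= g s) ->
  (forall s, is_derive u s (g s + q s * u s)) ->
  0 < u t0 -> t0 <= t -> 0 < u t.
Proof.
  intros Hq Hg Hu H0 Ht.
  set (I := fun s => RInt q t0 s).
  assert (HI : forall s, is_derive I s (q s)).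
  { intros s. apply is_derive_RInt with t0; [|apply Hq].
    apply filter_forall. intros b. apply RInt_correct, ex_RInt_continuous.
    intros; apply Hq. }
  assert (HE : - (u t * exp (- I t)) - - (u t0 * exp (- I t0)) <= 0 * (t - t0)).
  { apply (increment_le (fun s => - (u s * exp (- I s))) (fun s => - (g s * exp (- I s)))); [lra| |].
    - intros s _. auto_derive.
      + repeat split; eexists; [apply Hu | apply HI].
      + rewrite (is_derive_unique (fun x : R => u x) _ _ (Hu s)), (is_derive_unique (fun x : R => I x) _ _ (HI s)). ring.
    - intros s _. assert (H := exp_pos (- I s)). specialize (Hg s). nra. }
  assert (H1 := exp_pos (- I t)). assert (H2 := exp_pos (- I t0)). nra.
Qed.

(** * The autonomous planar system and its global convergence *)

Section PlanarSystem.

Variables (A c m K B k t0 : R) (y w : R -> R).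
Hypotheses (HA : 0 < A) (Hm : 0 < m) (HK : 0 < K) (HB : 0 < B) (Hk : 0 < k).
Hypothesis HP : 0 < A + c * (K / B) - m * (K / B) ^ 2.
Hypothesis Hw : forall t, 0 < w t.
Hypothesis Dy : forall t, is_derive y t (A - c * y t - m * y t ^ 2 - w t * (K + B * y t)).
Hypothesis Dw : forall t, is_derive w t (k * w t * y t).
Hypothesis Hstart : 0 < K + B * y t0.

(** With P(y) = A - c y - m y^2, one has P(y) = P(-K/B) + (y + K/B) (-c - m (y - K/B)). Hence u = K
    + B y solves a linear equation with forcing B P(-K/B), which is positive by [HP]. *)
Lemma invariant_half_plane t : t0 <= t -> 0 < K + B * y t.
Proof.
  apply linear_ode_pos with
    (u := fun t => K + B * y t)
    (g := fun _ => B * (A + c * (K / B) - m * (K / B) ^ 2))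
    (q := fun t => - c - m * (y t - K / B) - B * w t); [| |  |exact Hstart].
  - intros s. apply (ex_derive_continuous (fun t => - c - m * (y t - K / B) - B * w t)).
    auto_derive. repeat split; eexists; [apply Dy | apply Dw].
  - intros _. nra.
  - intros s. auto_derive.
    + eexists; apply Dy.
    + rewrite (is_derive_unique (fun x : R => y x) _ _ (Dy s)). field. lra.
Qed.

Definition lyapunov (t : R) : R :=
  k / B ^ 2 * (K + B * y t - K * ln (K + B * y t)) + (w t - A / K * ln (w t)).

(** The weights cancel the coupling, leaving k y (P(y) / u - A / K) with u = K + B y. The bracket
    vanishes at y = 0, so a second factor y splits off. *)
Lemma lyapunov_derive t : t0 <= t ->
  is_derive lyapunov t
    (- k * y t ^ 2 * ((A + c * (K / B) - m * (K / B) ^ 2) * B / (K * (K + B * y t)) + m / B)).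
Proof.
  intros Ht. assert (Hu := invariant_half_plane t Ht). assert (Hwt := Hw t).
  unfold lyapunov. auto_derive.
  - repeat split; try assumption;
      match goal with |- ex_derive ?f _ =>
        lazymatch f with context [y] => eexists; apply Dy | _ => eexists; apply Dw end end.
  - rewrite (is_derive_unique (fun x : R => y x) _ _ (Dy t)), (is_derive_unique (fun x : R => w x) _ _ (Dw t)).
    field. repeat split; lra.
Qed.

Lemma lyapunov_derive_le t : t0 <= t ->
  - k * y t ^ 2 * ((A + c * (K / B) - m * (K / B) ^ 2) * B / (K * (K + B * y t)) + m / B)
  <= - (k * m / B) * y t ^ 2.
Proof.
  intros Ht. assert (Hu := invariant_half_plane t Ht).
  assert (0 < (A + c * (K / B) - m * (K / B) ^ 2) * B / (K * (K + B * y t))).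
  { apply Rdiv_lt_0_compat; apply Rmult_lt_0_compat; assumption. }
  assert (0 <= k * y t ^ 2) by (apply Rmult_le_pos; [lra|apply pow2_ge_0]).
  replace (- (k * m / B) * y t ^ 2) with (- (k * y t ^ 2) * (m / B)) by (field; lra).
  nra.
Qed.

Lemma lyapunov_le_start t : t0 <= t -> lyapunov t <= lyapunov t0.
Proof.
  intros Ht.
  enough (lyapunov t - lyapunov t0 <= 0 * (t - t0)) by lra.
  eapply increment_le; [exact Ht | intros; apply lyapunov_derive; lra|].
  intros s Hs. cbv beta. apply Rle_trans with (1 := lyapunov_derive_le s ltac:(lra)).
  assert (0 < k * m / B) by (apply Rdiv_lt_0_compat; [apply Rmult_lt_0_compat|]; assumption).
  assert (0 <= y s ^ 2) by apply pow2_ge_0. nra.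
Qed.

(** Each of the two summands of [lyapunov] is bounded below by its minimum, so the monotonicity of
    the sum bounds each of them above, and with them [y] and [w]. *)
Lemma trajectory_bounded :
  exists Y W b, forall t, t0 <= t -> Rabs (y t) <= Y /\ w t <= W /\ b <= lyapunov t.
Proof.
  assert (HAK : 0 < A / K) by (apply Rdiv_lt_0_compat; assumption).
  assert (HkB : 0 < k / B ^ 2) by (apply Rdiv_lt_0_compat; [|apply pow_lt]; assumption).
  set (b1 := k / B ^ 2 * (K - K * ln K)).
  set (b2 := A / K - A / K * ln (A / K)).
  set (U := 2 * ((lyapunov t0 - b2) / (k / B ^ 2) + K * ln (2 * K))).
  exists ((U + K) / B), (2 * (lyapunov t0 - b1 + A / K * ln (2 * (A / K)))), (b1 + b2).
  intros t Ht.
  assert (Hu := invariant_half_plane t Ht). assert (Hwt := Hw t).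
  assert (HL := lyapunov_le_start t Ht).
  assert (H1 : b1 <= k / B ^ 2 * (K + B * y t - K * ln (K + B * y t))).
  { apply Rmult_le_compat_l; [lra|]. now apply sub_ln_ge. }
  assert (H2 : b2 <= w t - A / K * ln (w t)) by now apply sub_ln_ge.
  unfold lyapunov at 1 in HL.
  assert (HU : K + B * y t <= U).
  { apply le_of_sub_ln_le; [assumption|assumption|].
    apply Rmult_le_reg_l with (k / B ^ 2); [assumption|].
    replace (k / B ^ 2 * ((lyapunov t0 - b2) / (k / B ^ 2))) with (lyapunov t0 - b2)
      by (field; lra).
    lra. }
  split; [|split].
  - assert (Hy : B * Rabs (y t) <= U + K).
    { rewrite <- (Rabs_pos_eq B) at 1 by lra. rewrite <- Rabs_mult. apply Rabs_le. lra. }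
    apply Rmult_le_reg_l with B; [assumption|].
    replace (B * ((U + K) / B)) with (U + K) by (field; lra). exact Hy.
  - apply le_of_sub_ln_le; [assumption|assumption|]. lra.
  - unfold lyapunov. lra.
Qed.

(* [lyapunov] only dissipates [y ^ 2]; adding a small multiple of the cross
   term [y * (w - A / K)] makes it dissipate [(w - A / K) ^ 2] as well. *)
Lemma planar_system_lim : is_lim w p_infty (A / K).
Proof.
  destruct trajectory_bounded as [Y [W [b Hbd]]].
  assert (HY : 0 <= Y).
  { destruct (Hbd t0 ltac:(lra)) as [H _]. assert (H' := Rabs_pos (y t0)). lra. }
  assert (HW : 0 < W).
  { destruct (Hbd t0 ltac:(lra)) as [_ [H _]]. assert (H' := Hw t0). lra. }
  assert (HAK : 0 < A / K) by (apply Rdiv_lt_0_compat; assumption).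
  (* [Q] bounds the damping q = c + m y + B w in y' = - K (w - A / K) - q y. *)
  set (Q := Rabs c + m * Y + B * W).
  assert (HQ : 0 <= Q).
  { unfold Q. assert (H := Rabs_pos c). nra. }
  (* The cross term has derivative at most - (K / 2) (w - A / K)^2 + [S] y^2. The choice of [eps]
     makes [eps * S] equal to the dissipation rate k m / B of [lyapunov], so the y^2 terms
     cancel. *)
  set (S := Q ^ 2 / (2 * K) + k * W).
  assert (HS : 0 < S).
  { unfold S. assert (0 <= Q ^ 2 / (2 * K)).
    { apply Rmult_le_pos; [apply pow2_ge_0|]. left; apply Rinv_0_lt_compat; lra. }
    nra. }
  set (eps := k * m / B / S).
  assert (Heps : 0 < eps).
  { repeat apply Rdiv_lt_0_compat; try apply Rmult_lt_0_compat; assumption. }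
  assert (Hlim : is_lim (fun t => w t - A / K) p_infty 0).
  { apply barbalat with
      (V := fun t => lyapunov t + eps * (y t * (w t - A / K)))
      (dV := fun t =>
        - k * y t ^ 2 * ((A + c * (K / B) - m * (K / B) ^ 2) * B / (K * (K + B * y t)) + m / B)
        + eps * ((A - c * y t - m * y t ^ 2 - w t * (K + B * y t)) * (w t - A / K)
                 + y t * (k * w t * y t)))
      (dx := fun t => k * w t * y t)
      (* The [+ 1] makes [M] positive, as [Y] is only known to be nonnegative. *)
      (t0 := t0) (c := eps * K / 2) (M := k * W * Y + 1)
      (b := b - eps * (Y * (W + A / K))).
    - nra.
    - assert (0 <= k * W * Y) by (repeat apply Rmult_le_pos; lra). lra.
    - intros t Ht. auto_derive.
      + repeat split; eexists; [apply lyapunov_derive, Ht | apply Dy | apply Dw].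
      + rewrite (is_derive_unique (fun x : R => lyapunov x) _ _ (lyapunov_derive t Ht)),
          (is_derive_unique (fun x : R => y x) _ _ (Dy t)),
          (is_derive_unique (fun x : R => w x) _ _ (Dw t)). ring.
    - intros t Ht. auto_derive.
      + eexists; apply Dw.
      + rewrite (is_derive_unique (fun x : R => w x) _ _ (Dw t)). ring.
    - intros t Ht.
      destruct (Hbd t Ht) as [Hy [HwW _]]. assert (Hwt := Hw t).
      assert (HL := lyapunov_derive_le t Ht).
      assert (Hq : Rabs (c + m * y t + B * w t) <= Q).
      { unfold Q.
        eapply Rle_trans; [apply Rabs_triang|].
        apply Rplus_le_compat; [eapply Rle_trans; [apply Rabs_triang|];
                                apply Rplus_le_compat_l|].
        - rewrite Rabs_mult, (Rabs_pos_eq m) by lra. apply Rmult_le_compat_l; lra.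
        - rewrite Rabs_pos_eq by nra. apply Rmult_le_compat_l; lra. }
      set (q := c + m * y t + B * w t) in *.
      replace (A - c * y t - m * y t ^ 2 - w t * (K + B * y t))
        with (- K * (w t - A / K) - q * y t) by (unfold q; field; lra).
      set (x := w t - A / K).
      assert (Hq2 : q ^ 2 <= Q ^ 2).
      { rewrite <- (pow2_abs q). apply pow_incr. split; [apply Rabs_pos|assumption]. }
      assert (Hy2 : 0 <= y t ^ 2) by apply pow2_ge_0.
      (* Young's inequality, by expanding the square of K x + q y. *)
      assert (Hcross : - q * y t * x <= K / 2 * x ^ 2 + Q ^ 2 / (2 * K) * y t ^ 2).
      { assert (H0 : 0 <= (K * x + q * y t) ^ 2) by apply pow2_ge_0.
        apply Rmult_le_reg_l with (2 * K); [lra|].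
        replace (2 * K * (K / 2 * x ^ 2 + Q ^ 2 / (2 * K) * y t ^ 2))
          with (K ^ 2 * x ^ 2 + Q ^ 2 * y t ^ 2) by (field; lra).
        nra. }
      assert (Hkw : k * w t * y t ^ 2 <= k * W * y t ^ 2).
      { apply Rmult_le_compat_r; [assumption|]. apply Rmult_le_compat_l; lra. }
      assert (HepsS : eps * S = k * m / B) by (unfold eps; field; split; lra).
      assert (Hfin : (- K * x - q * y t) * x + y t * (k * w t * y t)
                     <= - (K / 2) * x ^ 2 + S * y t ^ 2).
      { unfold S. lra. }
      apply Rmult_le_compat_l with (r := eps) in Hfin; [|lra].
      rewrite <- HepsS in HL. lra.
    - intros t Ht. destruct (Hbd t Ht) as [Hy [HwW _]]. assert (Hwt := Hw t).
      rewrite !Rabs_mult, (Rabs_pos_eq k), (Rabs_pos_eq (w t)) by lra.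
      assert (k * w t * Rabs (y t) <= k * W * Y); [|lra].
      apply Rmult_le_compat; [nra|apply Rabs_pos| |assumption].
      apply Rmult_le_compat_l; lra.
    - intros t Ht. destruct (Hbd t Ht) as [Hy [HwW Hb]]. assert (Hwt := Hw t).
      assert (Hyx : Rabs (y t * (w t - A / K)) <= Y * (W + A / K)).
      { rewrite Rabs_mult. apply Rmult_le_compat; try apply Rabs_pos; [assumption|].
        apply Rabs_le. lra. }
      apply Rabs_le_between in Hyx. nra. }
  apply is_lim_ext with (fun t => w t - A / K + A / K); [intros; ring|].
  replace (Finite (A / K)) with (Rbar_plus 0 (A / K)) by (simpl; f_equal; ring).
  apply is_lim_plus with 0 (A / K); [exact Hlim | apply is_lim_const | reflexivity].
Qed.

End PlanarSystem.

(** * The radial equation in the variable t = ln r, with [N] standing for n - 1 *)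

Section LogVariable.

Variables (N m alpha beta : R) (v : R -> R).
Hypothesis Hm : 0 < m.
Hypothesis Hv : forall r, 0 < r -> 0 < v r.
Hypothesis D1 : forall r, 0 < r -> ex_derive v r.
Hypothesis D2 : forall r, 0 < r -> ex_derive (Derive v) r.

Lemma powf_derive r : 0 < r ->
  Derive (powf v m) r = m * Rpower (v r) m * (Derive v r / v r).
Proof.
  intros Hr. assert (Hvr := Hv r Hr).
  apply is_derive_unique. unfold powf, Rpower. auto_derive.
  - repeat split; [now apply D1 | assumption].
  - change (Derive (fun x : R => v x) r) with (Derive v r). field. lra.
Qed.

Lemma powf_derive2 r : 0 < r ->
  Derive (Derive (powf v m)) r =
  m * Rpower (v r) m *
    (m * (Derive v r / v r) ^ 2 + Derive (Derive v) r / v r - (Derive v r / v r) ^ 2).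
Proof.
  intros Hr. assert (Hvr := Hv r Hr).
  rewrite (Derive_ext_loc _ (fun r => m * Rpower (v r) m * (Derive v r / v r))).
  - apply is_derive_unique. unfold Rpower. auto_derive.
    + repeat split; try (now apply D1); [assumption| |lra]. now apply D2.
    + change (Derive (fun x : R => v x) r) with (Derive v r).
      change (Derive (fun x : R => Derive v x) r) with (Derive (Derive v) r). field. lra.
  (* The ball of radius [r] about [r] stays in (0, oo), where the first derivative is known. *)
  - exists (mkposreal r Hr). intros s Hs. apply powf_derive.
    apply Rabs_lt_between' in Hs. simpl in Hs. lra.
Qed.

Hypothesis ODE : forall r, 0 < r ->
  N / m * (Derive (Derive (powf v m)) r + N / r * Derive (powf v m) r)
  + alpha * v r + beta * r * Derive v r = 0.

(** This is d(ln v) / d(ln r), before the shift by 2 / (1 - m) that centres it at the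
    equilibrium. *)
Let zlog (t : R) : R := exp t * Derive v (exp t) / v (exp t).
Let wlog (t : R) : R := exp t ^ 2 * Rpower (v (exp t)) (1 - m).

(** Directly, z' = z - z^2 + r^2 v'' / v; the equation eliminates v'', and its lower-order terms
    carry the factor r^2 v / v^m = [wlog]. *)
Lemma zlog_derive t : 0 < N ->
  is_derive zlog t
    (- m * zlog t ^ 2 - (N - 1) * zlog t - wlog t * (alpha + beta * zlog t) / N).
Proof.
  intros HN. assert (Hr := exp_pos t). assert (Hvr := Hv _ Hr).
  assert (H := ODE _ Hr). rewrite powf_derive, powf_derive2 in H by assumption.
  unfold zlog, wlog. auto_derive.
  - repeat split; [now apply D2 | now apply D1 | lra].
  - change (Derive (fun x : R => v x) (exp t)) with (Derive v (exp t)).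
    change (Derive (fun x : R => Derive v x) (exp t)) with (Derive (Derive v) (exp t)).
    set (r := exp t) in *.
    assert (Hp : 0 < Rpower (v r) m) by apply exp_pos.
    assert (Hw : Rpower (v r) (1 - m) = v r / Rpower (v r) m).
    { unfold Rminus. rewrite Rpower_plus, Rpower_1, Rpower_Ropp by assumption. reflexivity. }
    rewrite Hw. clear Hw.
    set (p := Rpower (v r) m) in *.
    set (d := Derive v r) in *.
    assert (H2 : Derive (Derive v) r =
      v r * (- (m * (d / v r) ^ 2 - (d / v r) ^ 2) - N / r * (d / v r)
             - (alpha * v r + beta * r * d) / (N * p))).
    (* The factor is the coefficient of v'' in the equation; once the remaining terms are added,
       both sides vanish, the left one by [H]. *)
    { apply Rmult_eq_reg_l with (N * p / v r).
      2: { apply Rgt_not_eq, Rdiv_lt_0_compat; [apply Rmult_lt_0_compat|]; assumption. }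
      apply Rplus_eq_reg_l with
        (N * p * (m * (d / v r) ^ 2 - (d / v r) ^ 2 + N / r * (d / v r))
         + alpha * v r + beta * r * d).
      transitivity 0; [rewrite <- H; field | field]; repeat split; lra. }
    rewrite H2. field. repeat split; lra.
Qed.

Lemma wlog_derive t : is_derive wlog t (wlog t * (2 + (1 - m) * zlog t)).
Proof.
  assert (Hr := exp_pos t). assert (Hvr := Hv _ Hr).
  unfold zlog, wlog, Rpower. auto_derive.
  - repeat split; [now apply D1 | assumption].
  - change (Derive (fun x : R => v x) (exp t)) with (Derive v (exp t)). field. lra.
Qed.

End LogVariable.

(** * Behaviour near the origin, and the conclusion *)

(** The expression tends to alpha eta > 0 at the origin. It is a positive multiple of K + B y, so it
    supplies a starting time in the invariant half plane. *)
Lemma radial_start (v : R -> R) (eta alpha beta : R) :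
  0 < eta -> 0 < alpha -> 0 < beta ->
  filterlim v (at_right 0) (locally eta) ->
  filterlim (Derive v) (at_right 0) (locally 0) ->
  exists r, 0 < r /\ 0 < alpha * v r + beta * r * Derive v r.
Proof.
  intros Heta Ha Hb Lv Ldv.
  assert (He : 0 < eta / 2) by lra.
  assert (Hd : 0 < alpha * eta / (2 * beta))
    by (apply Rdiv_lt_0_compat; [apply Rmult_lt_0_compat|]; lra).
  destruct (Lv _ (locally_ball eta (mkposreal _ He))) as [d1 H1].
  destruct (Ldv _ (locally_ball 0 (mkposreal _ Hd))) as [d2 H2].
  (* Halving gives strict bounds; [r < 1] lets the bound on v' control r v'. *)
  set (r := Rmin 1 (Rmin d1 d2) / 2).
  assert (Hd1 := cond_pos d1). assert (Hd2 := cond_pos d2).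
  assert (Hmin : 0 < Rmin 1 (Rmin d1 d2)) by (repeat apply Rmin_glb_lt; lra).
  assert (Hm1 := Rmin_l 1 (Rmin d1 d2)). assert (Hm2 := Rmin_r 1 (Rmin d1 d2)).
  assert (Hm3 := Rmin_l d1 d2). assert (Hm4 := Rmin_r d1 d2).
  assert (Hr : 0 < r) by (unfold r; lra).
  assert (Hr1 : r < 1 /\ r < d1 /\ r < d2) by (unfold r; lra).
  assert (Hball : forall d : posreal, r < d -> ball 0 d r).
  { intros d Hlt. apply Rabs_lt_between'. lra. }
  exists r. split; [assumption|].
  specialize (H1 r (Hball d1 ltac:(lra)) Hr). specialize (H2 r (Hball d2 ltac:(lra)) Hr).
  apply Rabs_lt_between' in H1, H2. simpl in H1, H2.
  assert (Hb1 : - (alpha * eta / 2) < beta * Derive v r).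
  { replace (alpha * eta / 2) with (beta * (alpha * eta / (2 * beta))) by (field; lra). nra. }
  assert (alpha * (eta / 2) < alpha * v r) by (apply Rmult_lt_compat_l; lra).
  assert (0 < alpha * eta) by (apply Rmult_lt_0_compat; assumption).
  nra.
Qed.

Theorem theorem1p1 (n : nat) (m eta rho alpha beta : R) (v : R -> R) :
  (3 <= n)%nat ->
  0 < m -> m < (INR n - 2) / INR n ->
  0 < eta -> 0 < rho ->
  alpha = (2 * beta + rho) / (1 - m) ->
  beta > m * rho / (INR n - 2 - m * INR n) ->
  (* v is a positive, twice differentiable function on (0, oo) *)
  (forall r, 0 < r -> 0 < v r) ->
  (forall r, 0 < r -> ex_derive v r) ->
  (forall r, 0 < r -> ex_derive (Derive v) r) ->
  (* the ODE on (0, oo) *)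
  (forall r, 0 < r ->
     (INR n - 1) / m *
       (Derive (Derive (powf v m)) r
        + (INR n - 1) / r * Derive (powf v m) r)
     + alpha * v r + beta * r * Derive v r = 0) ->
  (* initial conditions: v(0) = eta, v'(0) = 0, v in C^1([0, oo)) *)
  v 0 = eta ->
  filterlim v (at_right 0) (locally eta) ->
  filterlim (Derive v) (at_right 0) (locally 0) ->
  is_lim (fun r => r ^ 2 * Rpower (v r) (1 - m)) p_infty
    (2 * (INR n - 1) * (INR n * (1 - m) - 2)
     / ((1 - m) * (alpha * (1 - m) - 2 * beta))).
Proof.
  intros Hn Hm Hmn Heta Hrho Halpha Hbeta Hv D1 D2 ODE _ Lv Ldv.
  assert (HN : 3 <= INR n) by (apply (le_INR 3) in Hn; simpl in Hn; lra).
  set (N := INR n) in *.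
  assert (Hd : 0 < N - 2 - m * N).
  { apply Rmult_lt_compat_r with (r := N) in Hmn; [|lra].
    replace ((N - 2) / N * N) with (N - 2) in Hmn by (field; lra). lra. }
  assert (Hm1 : m < 1) by nra.
  assert (Hbd : m * rho < beta * (N - 2 - m * N)).
  { apply Rmult_lt_compat_r with (r := N - 2 - m * N) in Hbeta; [|lra].
    replace (m * rho / (N - 2 - m * N) * (N - 2 - m * N)) with (m * rho) in Hbeta
      by (field; lra). lra. }
  assert (Hb : 0 < beta) by nra.
  assert (Ha : 0 < alpha) by (rewrite Halpha; apply Rdiv_lt_0_compat; lra).
  assert (Hab : alpha * (1 - m) = 2 * beta + rho) by (rewrite Halpha; field; lra).
  destruct (radial_start v eta alpha beta Heta Ha Hb Lv Ldv) as [r0 [Hr0 Hstart]].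
  set (z := fun t => exp t * Derive v (exp t) / v (exp t)).
  set (w := fun t => exp t ^ 2 * Rpower (v (exp t)) (1 - m)).
  (* Substituting z = y - 2 / (1 - m): [K] is (alpha - 2 beta / (1 - m)) / (n - 1), and [A] is the
     value of - m z^2 - (n - 2) z at y = 0. *)
  set (K := rho / ((1 - m) * (N - 1))).
  set (A := 2 * (N - 2 - N * m) / (1 - m) ^ 2).
  assert (Hlim : is_lim w p_infty (A / K)).
  { apply planar_system_lim with (c := N - 2 - 4 * m / (1 - m)) (m := m)
      (B := beta / (N - 1)) (k := 1 - m) (t0 := ln r0) (y := fun t => z t + 2 / (1 - m)).
    - apply Rdiv_lt_0_compat; [lra|apply pow_lt; lra].
    - assumption.
    - apply Rdiv_lt_0_compat; [lra|apply Rmult_lt_0_compat; lra].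
    - apply Rdiv_lt_0_compat; lra.
    - lra.
    - unfold A, K.
      (* The lower bound on [beta] enters here, as the positivity of the middle factor. *)
      match goal with |- 0 < ?l => replace l with (alpha / beta * (beta * (N - 2 - m * N) - m * rho) / (beta * (1 - m))) end.
      + apply Rdiv_lt_0_compat; [apply Rmult_lt_0_compat; [apply Rdiv_lt_0_compat|]|apply Rmult_lt_0_compat]; lra.
      + rewrite Halpha. field. repeat split; lra.
    - intros t. apply Rmult_lt_0_compat; [apply pow_lt|]; apply exp_pos.
    - intros t.
      match goal with |- is_derive _ _ ?l => replace l with (- m * z t ^ 2 - (N - 1 - 1) * z t - w t * (alpha + beta * z t) / (N - 1) + 0) end.
      + apply (is_derive_plus z (fun _ => 2 / (1 - m)) t _ 0); [|exact (is_derive_const (2 / (1 - m)) t)].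
        apply (zlog_derive (N - 1) m alpha beta v); auto; lra.
      + unfold A, K. rewrite Halpha. field. repeat split; lra.
    - intros t.
      match goal with |- is_derive _ _ ?l =>
        replace l with (w t * (2 + (1 - m) * z t)) by (field; lra) end.
      now apply wlog_derive.
    - unfold K, z. rewrite exp_ln by assumption.
      assert (Hvr := Hv r0 Hr0).
      (* At time ln r0, K + B y is the quantity from [radial_start] divided by (n - 1) v(r0). *)
      match goal with |- 0 < ?l => replace l with ((alpha * v r0 + beta * r0 * Derive v r0) / ((N - 1) * v r0)) end.
      + apply Rdiv_lt_0_compat; [|apply Rmult_lt_0_compat]; lra.
      + rewrite Halpha. field. repeat split; lra. }
  replace (2 * (N - 1) * (N * (1 - m) - 2) / ((1 - m) * (alpha * (1 - m) - 2 * beta)))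
    with (A / K).
  2: { rewrite Hab. unfold A, K. field. repeat split; lra. }
  apply is_lim_ext_loc with (fun r => w (ln r)).
  - exists 0. intros r Hr. unfold w. now rewrite exp_ln.
  - apply is_lim_comp with p_infty; [exact Hlim | exact is_lim_ln_p |].
    now exists 0.
Qed.
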